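(* Let $\{a_k\}_{k=0}^\infty$ be any nonzero (i.e. not identically zero) solution to a recurrence relation of Poincaré type $$a_k=\sum_{j=1}^d[c_j+\psi_j(k)]\cdot a_{k-j},\qquad k=d,d+1,\dots,\qquad \lim_{k\to\infty}\psi_j(k)=0\quad(j=1,\dots,d),$$ with initial data $\bar a=(a_0,\dots,a_{d-1})$, and let $R$ be the radius of convergence of the generating function $f(z)=\sum_{k=0}^\infty a_kz^k$. Then necessarily $R>0$, and in fact $R=|\sigma|^{-1}$, where $\sigma$ is some (depending on $\bar a$) characteristic root of the recurrence. Consequently, $f$ satisfies $(d-1,R,S(k))$-Taylor domination with $$S(k)=R^k|a_k|\,(|a_m|R^m)^{-1},$$ where $m$ is the index of the first nonzero Taylor coefficient of $f$.
   Context: Here the $c_j$ are fixed numbers. The characteristic roots of the recurrence are those of its constant part, i.e. the roots $\sigma_1,\dots,\sigma_d$ of the equation $\sigma^d-\sum_{j=1}^dc_j\sigma^{d-j}=0$. Taylor domination: let $f(z)=\sum_{k=0}^{\infty}a_kz^k$ be an analytic function whose Taylor series has radius of convergence $\hat R$, $0<\hat R\leq+\infty$. Let a positive finite $R\leq\hat R$, a natural number $N$ (the value $0$ being allowed), and a positive sequence $S(k)$ of subexponential growth (i.e. $\limsup_{k\to\infty}S(k)^{1/k}\leq 1$) be fixed. The function $f$ is said to possess an $(N,R,S(k))$-Taylor domination property if $|a_k|R^k\leq S(k)\max_{i=0,\dots,N}|a_i|R^i$ for each $k\geq N+1$.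
   Formalization: R=|σ|^{-1} (with 1/0=+∞) is asserted only for solutions not vanishing from some index on (it fails for 1,0,0,… with d=1, c_1=1, ψ_1(1)=-1); Taylor domination is asserted only for finite R, with S(k) nonnegative rather than positive, as S(k)=0 where a_k=0. *)

(* Defs.v *)
From mathcomp Require Export all_boot all_order all_algebra.
From mathcomp Require Export complex.
From mathcomp Require Export all_classical all_reals all_analysis.
Export Order.TTheory GRing.Theory Num.Theory.
Export numFieldNormedType.Exports.
Export ComplexField.Normc.

Set Implicit Arguments.
Unset Strict Implicit.
Unset Printing Implicit Defensive.

Local Open Scope classical_set_scope.
Local Open Scope ring_scope.
Local Open Scope complex_scope.

(* Moduli are taken with [normc], whose values are in R (the norm `|z| of the
   numDomainType structure lives in R[i]), and limits in the regular module
   R[i]^o, which is the alias carrying the usual topology. *)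

(* [psi j k] and [c j] are the perturbation and the constant with index j.+1 in
   the usual 1-based numbering. *)
Definition poincare_recurrence (R : realType) (d : nat) (c : 'I_d -> R[i])
    (psi : 'I_d -> nat -> R[i]) (a : nat -> R[i]) : Prop :=
  (forall j : 'I_d, psi j k @[k --> \oo] --> (0 : R[i]^o)) /\
  (forall k : nat, (d <= k)%N ->
     a k = \sum_(j < d) (c j + psi j k) * a (k - j.+1)%N).

Definition characteristic_root (R : realType) (d : nat) (c : 'I_d -> R[i])
    (sigma : R[i]) : Prop :=
  sigma ^+ d - \sum_(j < d) c j * sigma ^+ (d - j.+1) = 0.

(* A solution that is not identically zero can still vanish from some index on
   when c_d + psi_d(k) = 0 for some k. With d = 1, c_1 = 1, psi_1(1) = -1 and
   psi_1(k) = 0 otherwise, the sequence 1, 0, 0, ... is a solution whose radius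
   of convergence is +oo, while the only characteristic root is 1. *)
Definition eventually_zero (R : realType) (a : nat -> R[i]) : Prop :=
  exists n : nat, forall k : nat, (n <= k)%N -> a k = 0.

Definition radius_of_convergence (R : realType) (a : nat -> R[i]) : \bar R :=
  ereal_sup [set (normc z)%:E | z in
    [set z : R[i] | cvgn (series (fun k => a k * z ^+ k) : nat -> R[i]^o)]].

Definition subexponential (R : realType) (S : nat -> R) : Prop :=
  (limn_esup (fun k => (S k `^ (k%:R)^-1)%:E) <= 1)%E.

(* S is only required to be nonnegative: the sequence R^k |a_k| / (|a_m| R^m),
   to which the notion has to apply, vanishes wherever a_k does. *)
Definition taylor_domination (R : realType) (a : nat -> R[i]) (N : nat) (r : R)
    (S : nat -> R) : Prop :=
  [/\ 0 < r, (r%:E <= radius_of_convergence a)%E,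
      forall k : nat, 0 <= S k, subexponential S &
      forall k : nat, (N.+1 <= k)%N ->
        normc (a k) * r ^+ k
          <= S k * \big[Num.max/0]_(i < N.+1) (normc (a i) * r ^+ i)].

(* Main.v *)
Require Import Defs.
From mathcomp Require Import ring lra.

(**
  Let L = 1/R, with L = 0 if R is infinite. The recurrence bounds a_k by a geometric
  sequence, so R > 0 and L is finite; L is the exponential growth rate of (a_k), that is
  limsup |a_k|^(1/k). The claim is that a solution which is not eventually zero cannot
  have a growth rate L different from all moduli of characteristic roots.

  Write the characteristic polynomial as a product of factors X - s_i and follow the
  sequences w_i = (E - s_{i-1}) ... (E - s_0) a, i < d, with E the shift operator. At a
  fixed k they are a linear change of coordinates of the window a_k, ..., a_{k+d-1}
  (shift_chain_recover), and w_i(k+1) = s_i w_i(k) + w_{i+1}(k), where w_d consists of the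
  perturbation terms only (characteristic_shift) and is therefore negligible. After the
  rescaling w_i -> eta^-i w_i, each coordinate is multiplied by s_i at every step, up to
  an error eta times the largest coordinate. If every |s_i| is at distance at least
  2 eta from L, an invariant cone argument (cone_dichotomy) shows that either the
  coordinates with |s_i| > L win and the solution grows at least like (L + eta)^k, or those
  with |s_i| < L dominate forever and the solution is O((L - eta)^k). Both contradict the
  choice of L (growth_dichotomy, radius_characteristic). A triangular form with
  small entries off the diagonal thus takes the place of a spectral decomposition.

  The domination property then follows from the definition of S, because the first
  nonzero coefficient has index m < d, and because |a_k| R^k is O(t^k) for all t > 1.
*)

Set Implicit Arguments.
Unset Strict Implicit.
Unset Printing Implicit Defensive.

Local Open Scope classical_set_scope.
Local Open Scope ring_scope.
Local Open Scope complex_scope.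

(** * The modulus of a complex number *)

Section NormcFacts.
Variable R : realType.
Implicit Types z w : R[i].

Lemma normr_normc z : `|z| = (normc z)%:C.
Proof. by case: z. Qed.

Lemma normc_ge0 z : 0 <= normc z.
Proof. by case: z => x y; rewrite sqrtr_ge0. Qed.

Lemma ler_normcD z w : normc (z + w) <= normc z + normc w.
Proof. exact: le_normcD. Qed.

Lemma ler_normc_sum (I : Type) (s : seq I) (P : pred I) (F : I -> R[i]) :
  normc (\sum_(i <- s | P i) F i) <= \sum_(i <- s | P i) normc (F i).
Proof.
elim/big_ind2: _ => [|z1 z2 x1 x2 h1 h2|//]; first by rewrite normc0.
by apply: le_trans (ler_normcD _ _) _; exact: lerD.
Qed.

Lemma normc_distC z w : normc (z - w) = normc (w - z).
Proof. by rewrite -opprB; exact: normcN. Qed.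

Lemma ler_dist_normc z w : `|normc z - normc w| <= normc (z - w).
Proof.
rewrite ler_norml; apply/andP; split.
  have := ler_normcD (w - z) z; rewrite subrK normc_distC; lra.
have := ler_normcD (z - w) w; rewrite subrK; lra.
Qed.

Lemma normcX z n : normc (z ^+ n) = normc z ^+ n.
Proof. by elim: n => [|n IH]; rewrite ?normc1// !exprS normcM IH. Qed.

Lemma normc_real (x : R) : 0 <= x -> normc x%:C = x.
Proof. by move=> x0; rewrite /normc /= expr0n /= addr0 sqrtr_sqr ger0_norm. Qed.

Lemma normc_gt0 z : z <> 0 -> 0 < normc z.
Proof.
by move=> z0; rewrite lt_neqAle normc_ge0 andbT eq_sym; apply/eqP => /eq0_normc.
Qed.

Lemma ler_Re_normc z : `|complex.Re z| <= normc z.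
Proof. by have := normc_ge_Re z; rewrite normr_normc lecR. Qed.

Lemma ler_Im_normc z : `|complex.Im z| <= normc z.
Proof.
case: z => x y /=; rewrite -sqrtr_sqr ler_wsqrtr// lerDr sqr_ge0//.
Qed.

Lemma normc_le_ReIm z : normc z <= `|complex.Re z| + `|complex.Im z|.
Proof.
case: z => x y /=; rewrite -[leRHS]ger0_norm ?addr_ge0// -sqrtr_sqr ler_wsqrtr//.
rewrite sqrrD !real_normK ?num_real// addrAC lerDl mulrn_wge0// mulr_ge0//.
Qed.

End NormcFacts.

(** * Power series and geometric bounds *)

Section PowerSeries.
Variable R : realType.

Lemma cvg0_normc_lt (u : nat -> R[i]) (e : R) :
  u k @[k --> \oo] --> (0 : R[i]^o) -> 0 < e ->
  exists K, forall k, (K <= k)%N -> normc (u k) < e.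
Proof.
move=> h e0; have [K _ hK] : \forall k \near \oo, `|u k : R[i]^o| < e%:C.
  by apply: (@cvgr0_norm_lt R[i] R[i]^o _ _ _ u h); rewrite ltcR.
by exists K => k /hK /=; rewrite -[X in X < _]/(`|u k|) normr_normc ltcR.
Qed.

(** The completeness of R is used for the real and the imaginary part separately,
    and the two limits are put together. *)
Lemma geometric_dominated_cvg (b : nat -> R[i]) (C q : R) :
  0 <= q -> q < 1 -> (forall k, normc (b k) <= C * q ^+ k) ->
  cvgn (series b : nat -> R[i]^o).
Proof.
move=> q0 q1 hb.
have real_part (u : nat -> R) : (forall k, `|u k| <= normc (b k)) -> cvgn (series u).
  move=> hu; apply: normed_cvg.
  apply: (@series_le_cvg _ _ (geometric C q)) => [n|n|n|].
  - exact: normr_ge0.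
  - by apply: le_trans (hb n); exact: normc_ge0.
  - exact: le_trans (hu n) (hb n).
  - by apply: is_cvg_geometric_series; rewrite ger0_norm.
have /cvg_ex[x hx] := real_part _ (fun k => ler_Re_normc (b k)).
have /cvg_ex[y hy] := real_part _ (fun k => ler_Im_normc (b k)).
apply/cvg_ex; exists (x +i* y); apply/cvgrPdist_lt => e e0.
(* A positive element of R[i] is a positive real number. *)
have [eR eI] : e = (complex.Re e)%:C /\ 0 < complex.Re e.
  by move: e0; case: e => s t; rewrite ltcE /= => /andP[/eqP -> ?].
rewrite eR in e0 *; move: (complex.Re e) eI => {eR e0}e e0.
have e2 : 0 < e / 2 by lra.
near=> n.
rewrite -[X in X < _]/(`|(x +i* y) - series b n|) normr_normc ltcR.
apply: le_lt_trans (normc_le_ReIm _) _.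
have [-> ->] : complex.Re ((x +i* y) - series b n) = x - series (fun k => complex.Re (b k)) n
   /\ complex.Im ((x +i* y) - series b n) = y - series (fun k => complex.Im (b k)) n.
  rewrite /series /= -(raddf_sum (@complex.Re R : Rcomplex R -> R)).
  rewrite -(raddf_sum (@complex.Im R : Rcomplex R -> R)).
  by case: (\sum_(0 <= k < n) b k).
rewrite [e]splitr ltrD//; near: n.
  by move/cvgrPdist_lt : hx; exact.
by move/cvgrPdist_lt : hy; exact.
Unshelve. all: by end_near. Qed.

Lemma radius_ge_at (a : nat -> R[i]) (C s x : R) :
  0 <= s -> 0 <= x -> x * s < 1 -> (forall k, normc (a k) <= C * s ^+ k) ->
  (x%:E <= radius_of_convergence a)%E.
Proof.
move=> s0 x0 xs ha; apply: ereal_sup_ubound; exists x%:C; last by rewrite normc_real.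
apply: (@geometric_dominated_cvg _ C (x * s)) => // [|k]; first exact: mulr_ge0.
rewrite normcM normcX normc_real// exprMn mulrCA mulrC.
by rewrite ler_wpM2l ?exprn_ge0.
Qed.

(** The bound gives convergence only at the points x < 1/s; a radius smaller than
    1/s would be exceeded by the midpoint between it and 1/s. *)
Lemma radius_ge (a : nat -> R[i]) (C s : R) :
  0 < s -> (forall k, normc (a k) <= C * s ^+ k) ->
  (s^-1%:E <= radius_of_convergence a)%E.
Proof.
move=> s0 ha; rewrite leNgt; apply/negP => lt1.
have r0 : (0%:E <= radius_of_convergence a)%E.
  by apply: (radius_ge_at (ltW s0) _ _ ha); rewrite ?mul0r.
move: r0 lt1 (@radius_ge_at a C s); case: (radius_of_convergence a) => // r.
rewrite lee_fin lte_fin => r0 rs h.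
have rs1 : r * s < 1 by rewrite -ltr_pdivlMr// div1r.
have xs : (r + s^-1) / 2 * s = (r * s + 1) / 2 by field; rewrite gt_eqF.
have si : 0 < s^-1 by rewrite invr_gt0.
have := h ((r + s^-1) / 2) (ltW s0); rewrite lee_fin xs => h1.
suff : (r + s^-1) / 2 <= r by lra.
by apply: h1 => //; lra.
Qed.

Lemma bounded_of_eventually (f : nat -> R) (C : R) (K : nat) :
  (forall k, 0 <= f k) -> (forall k, (K <= k)%N -> f k <= C) ->
  exists2 B, 0 <= B & forall k, f k <= B.
Proof.
move=> f0 hf; exists (`|C| + \sum_(k < K) f k) => [|k].
  by rewrite addr_ge0// sumr_ge0.
case: (leqP K k) => hk.
  apply: le_trans (hf k hk) _; apply: le_trans (ler_norm _) _.
  by rewrite lerDl sumr_ge0.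
rewrite (bigD1 (Ordinal hk))//= addrCA lerDl addr_ge0// sumr_ge0//.
Qed.

(** Conversely, convergence at a point z with |z| > 1/s makes the terms
    a_k z^k tend to zero, hence bounded. *)
Lemma radius_gt_bound (a : nat -> R[i]) (s : R) :
  0 < s -> (s^-1%:E < radius_of_convergence a)%E ->
  exists C, forall k, normc (a k) <= C * s ^+ k.
Proof.
move=> s0 /ereal_sup_gt[_ [z /= hz <-]]; rewrite lte_fin => sz.
have [K hK] := cvg0_normc_lt (cvg_series_cvg_0 hz) ltr01.
have [B B0 hB] := bounded_of_eventually (fun k => normc_ge0 _) (fun k h => ltW (hK k h)).
exists B => k; rewrite -ler_pdivrMr ?exprn_gt0//.
apply: le_trans (hB k); rewrite normcM normcX ler_wpM2l ?normc_ge0//.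
by rewrite -exprVn lerXn2r ?nnegrE ?invr_ge0 ?normc_ge0 ?ltW.
Qed.

Lemma geometric_gap (C q t : R) : 0 <= q -> q < t ->
  exists K, forall k, (K <= k)%N -> C * q ^+ k <= t ^+ k.
Proof.
move=> q0 qt; have t0 : 0 < t by exact: le_lt_trans qt.
have /cvgrPdist_lt/(_ 1 ltr01) : geometric C (q / t) k @[k --> \oo] --> 0.
  by apply: cvg_geometric; rewrite ger0_norm ?(divr_ge0 q0 (ltW t0))// ltr_pdivrMr// mul1r.
move=> [K _ hK]; exists K => k /hK /=; rewrite sub0r normrN => h.
have := ltW (le_lt_trans (ler_norm _) h).
by rewrite expr_div_n mulrA ler_pdivrMr ?exprn_gt0// mul1r.
Qed.

(** The criterion avoids k-th roots of constants: C (1 + e/2)^k is eventually below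
    (1 + e)^k, whose k-th root is exactly 1 + e. *)
Lemma subexponential_of_bounds (S : nat -> R) : (forall k, 0 <= S k) ->
  (forall t, 1 < t -> exists C, forall k, S k <= C * t ^+ k) ->
  subexponential S.
Proof.
move=> S0 hS; apply/lee_addgt0Pr => e e0.
pose q := 1 + e / 2.
have [|C hC] := hS q; first by rewrite /q; lra.
have [q0 qe] : 0 <= q /\ q < 1 + e by split; rewrite /q; lra.
have [K hK] := geometric_gap C q0 qe.
rewrite /limn_esup limf_esupE.
apply: (@le_trans _ _ (ereal_sup
    [set (S k `^ (k%:R)^-1)%:E | k in [set k | (K.+1 <= k)%N]])).
  by apply: ereal_inf_lbound; exists [set k | (K.+1 <= k)%N] => //; exists K.+1.
apply: ge_ereal_sup => _ [k /= hk <-]; rewrite -[leRHS]/((1 + e)%:E) lee_fin.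
have -> : 1 + e = ((1 + e) ^+ k) `^ (k%:R)^-1.
  rewrite -powR_mulrn -?powRrM ?mulfV ?powRr1 ?pnatr_eq0 -?lt0n ?(leq_ltn_trans _ hk)//; lra.
apply: ge0_ler_powR; rewrite ?invr_ge0 ?nnegrE ?exprn_ge0//; first lra.
by apply: le_trans (hC k) _; apply: hK; exact: ltnW.
Qed.
End PowerSeries.

(** * An invariant cone argument *)

(** The hypothesis [step] says that each coordinate is multiplied by [mu i] up to an
    error eta times the largest coordinate. Let S and U be the maxima of the
    coordinates with mu < L and with mu > L. The cone U >= S is invariant, since
    there the next U is at least, and the next S at most, (L + eta) U. An
    orbit which enters the cone therefore grows like (L + eta)^n; an orbit which never
    does has S > U at all times, and then S shrinks by L - eta at each step. *)
Lemma cone_dichotomy (R : realType) (I : finType) (x : I -> nat -> R)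
    (mu : I -> R) (L eta : R) :
  0 <= L -> 0 < eta -> (forall i n, 0 <= x i n) ->
  (forall i, 0 <= mu i) ->
  (forall i, mu i <= L - 2 * eta \/ L + 2 * eta <= mu i) ->
  (forall i n X, (forall j, x j n <= X) ->
     `|x i n.+1 - mu i * x i n| <= eta * X) ->
  (forall n, exists i, 0 < x i n) ->
  (exists n0, exists2 u, 0 < u &
     forall n, exists i, (L + eta) ^+ n * u <= x i (n0 + n)%N) \/
  (0 < L - eta /\ exists C, forall i n, x i n <= (L - eta) ^+ n * C).
Proof.
move=> L0 e0 x0 mu0 gap step nz.
pose S n := \big[Num.max/0]_(i | mu i < L) x i n.
pose U n := \big[Num.max/0]_(i | ~~ (mu i < L)) x i n.
have S0 n : 0 <= S n by apply: bigmax_ge_id.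
have U0 n : 0 <= U n by apply: bigmax_ge_id.
have small i : mu i < L -> mu i <= L - 2 * eta.
  by move=> h; case: (gap i) => // h'; lra.
have big i : ~~ (mu i < L) -> L + 2 * eta <= mu i.
  by rewrite -leNgt => h; case: (gap i) => // h'; lra.
have xS i n : mu i < L -> x i n <= S n.
  by move=> h; exact: (le_bigmax_cond 0 (fun i => x i n)).
have xU i n : ~~ (mu i < L) -> x i n <= U n.
  by move=> h; exact: (le_bigmax_cond 0 (fun i => x i n)).
have xX i n X : S n <= X -> U n <= X -> x i n <= X.
  move=> hS hU; have [h|h] := boolP (mu i < L).
    exact: le_trans (xS _ _ h) hS.
  exact: le_trans (xU _ _ h) hU.
have Uwit n : 0 < U n -> exists2 i, ~~ (mu i < L) & U n = x i n.
  move=> h; apply: contrapT => hn.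
  suff : U n < U n by rewrite ltxx.
  rewrite {1}/U; elim/big_ind: _ => // [y z|i hi]; first by rewrite gt_max => -> ->.
  rewrite lt_neqAle xU// andbT; apply/eqP => e; apply: hn; by exists i.
have cone n : S n <= U n -> 0 < U n ->
    S n.+1 <= U n.+1 /\ (L + eta) * U n <= U n.+1.
  move=> SU Un0.
  have st i : `|x i n.+1 - mu i * x i n| <= eta * U n.
    by apply: step => j; exact: xX.
  have gr : (L + eta) * U n <= U n.+1.
    have [i hi e] := Uwit _ Un0.
    apply: le_trans (xU i _ hi); have := st i; rewrite ler_norml -e => /andP[h _].
    have := ler_wpM2r (U0 n) (big _ hi); lra.
  split=> //; apply: le_trans gr; apply: bigmax_le => [|i hi].
    by rewrite mulr_ge0// addr_ge0// ltW.
  have := st i; rewrite ler_norml => /andP[_ h].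
  have h1 := ler_pM (mu0 i) (x0 i n) (ltW hi) (le_trans (xS _ n hi) SU).
  lra.
have [[n0 [SU Un0]]|hn] := pselect (exists n, S n <= U n /\ 0 < U n).
  left; exists n0, (U n0) => // n.
  suff [_ hU hgr] : [/\ S (n0 + n)%N <= U (n0 + n)%N, 0 < U (n0 + n)%N &
      (L + eta) ^+ n * U n0 <= U (n0 + n)%N].
    by have [i _ e] := Uwit _ hU; exists i; rewrite -e.
  have Le : 0 < L + eta by lra.
  elim: n => [|n [h1 h2 h3]]; first by rewrite addn0 expr0 mul1r.
  rewrite addnS; have [h4 h5] := cone _ h1 h2; split=> //.
    by apply: lt_le_trans h5; rewrite mulr_gt0.
  by apply: le_trans h5; rewrite exprS -mulrA ler_pM2l.
have US n : U n < S n.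
  rewrite ltNge; apply/negP => h; apply: hn; exists n; split=> //.
  have [i hi] := nz n; apply: lt_le_trans hi _; exact: xX.
have Sp n : 0 < S n by apply: le_lt_trans (US n).
have dec n : S n.+1 <= (L - eta) * S n.
  suff : S n.+1 <= Num.max 0 ((L - eta) * S n).
    by rewrite le_max => /orP[|//]; rewrite leNgt Sp.
  apply: bigmax_le => [|i hi]; first by rewrite le_max lexx.
  rewrite le_max; apply/orP; right.
  have := step i n (S n) (fun j => xX j n _ (lexx _) (ltW (US n))).
  rewrite ler_norml => /andP[_ h1].
  have h2 := ler_wpM2r (x0 i n) (small i hi).
  have h3 : (L - 2 * eta) * x i n <= (L - 2 * eta) * S n.
    by apply: ler_wpM2l (xS i n hi); exact: le_trans (mu0 i) (small i hi).
  lra.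
have Le : 0 < L - eta.
  by have := lt_le_trans (Sp 1%N) (dec 0%N); rewrite pmulr_lgt0.
right; split=> //; exists (S 0%N) => i n; apply: le_trans (xX i n _ (lexx _) (ltW (US n))) _.
elim: n => [|n IH]; first by rewrite expr0 mul1r.
by apply: le_trans (dec n) _; rewrite exprS -mulrA ler_pM2l.
Qed.

(** * Triangular coordinates for a linear recurrence *)

(** The sequences (E - s_{i-1}) ... (E - s_0) a, where E is the shift operator.
    Following them from k to k+1 is a triangular system with diagonal s_0, s_1, .... *)
Fixpoint shift_chain (K : pzRingType) (s : nat -> K) (a : nat -> K) (i k : nat) : K :=
  if i is i'.+1 then shift_chain s a i' k.+1 - s i' * shift_chain s a i' k
  else a k.

Lemma shift_chainE (K : idomainType) (s a : nat -> K) i k :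
  shift_chain s a i k =
  \sum_(l < i.+1) (\prod_(j < i) ('X - (s j)%:P))`_l * a (k + l)%N.
Proof.
elim: i k => [|i IH] k.
  by rewrite big_ord0 big_ord1 coef1 eqxx mul1r addn0.
rewrite [LHS]/= !IH; set p := \prod_(j < i) _.
have -> : \prod_(j < i.+1) ('X - (s j)%:P) = p * ('X - (s i)%:P) by rewrite big_ord_recr.
have p0 : p`_i.+1 = 0 by rewrite nth_default// size_prod_XsubC /index_enum -enumT size_enum_ord.
under [in RHS]eq_bigr do rewrite mulrBr coefB coefMX coefMC mulrBl.
rewrite sumrB [in RHS]big_ord_recl /= mul0r add0r; congr (_ - _).
  by apply: eq_bigr => l _ /=; rewrite /bump add1n addSnnS.
rewrite [in RHS]big_ord_recr /= p0 !mul0r addr0 mulr_sumr.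
by apply: eq_bigr => l _; rewrite mulrCA mulrA.
Qed.

Lemma uniform_threshold (I : finType) (P : I -> nat -> Prop) :
  (forall i, exists K, forall k, (K <= k)%N -> P i k) ->
  exists K, forall k, (K <= k)%N -> forall i, P i k.
Proof.
move=> /choice[f hf]; exists (\max_i f i) => k hk i; apply: hf.
exact: leq_trans (leq_bigmax i) hk.
Qed.

(** * Factorization of the characteristic polynomial *)

Section Factor.
Variables (R : realType) (d : nat) (c : 'I_d -> R[i]).

Definition characteristic_poly : {poly R[i]} :=
  'X^d - \sum_(j < d) c j *: 'X^(d - j.+1).

Lemma size_characteristic_tail : (size (\sum_(j < d) c j *: 'X^(d - j.+1))%R <= d)%N.
Proof.
apply: (leq_trans (size_sum _ _ _)); apply/bigmax_leqP => j _.
by apply: (leq_trans (size_scale_leq _ _)); rewrite size_polyXn subnSK ?leq_subr.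
Qed.

Lemma characteristic_poly_root sigma :
  root characteristic_poly sigma -> characteristic_root c sigma.
Proof.
move=> /rootP; rewrite /characteristic_poly /characteristic_root hornerD hornerN.
rewrite hornerXn horner_sum => h; rewrite -[RHS]h; congr (_ - _).
by apply: eq_bigr => j _; rewrite hornerZ hornerXn.
Qed.

Lemma characteristic_factorization :
  exists2 s : nat -> R[i], characteristic_poly = \prod_(j < d) ('X - (s j)%:P) &
    forall j, (j < d)%N -> characteristic_root c (s j).
Proof.
have [r hr] := closed_field_poly_normal characteristic_poly.
have tl : (size (- \sum_(j < d) c j *: 'X^(d - j.+1))%R < size ('X^d : {poly R[i]}))%N.
  by rewrite size_polyN size_polyXn ltnS size_characteristic_tail.
have lc : lead_coef characteristic_poly = 1 by rewrite lead_coefDl// lead_coefXn.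
have szP : size characteristic_poly = d.+1 by rewrite size_polyDl// size_polyXn.
rewrite lc scale1r in hr.
have szr : size r = d by move: szP; rewrite hr size_prod_XsubC => -[].
have hs : characteristic_poly = \prod_(j < d) ('X - (nth 0 r j)%:P).
  by rewrite hr (big_nth 0) big_mkord szr.
exists (nth 0 r) => // j jd; apply: characteristic_poly_root.
by rewrite hr root_prod_XsubC mem_nth// szr.
Qed.

(** Applying all d factors E - s_j amounts to applying the characteristic
    polynomial to E; on a solution only the perturbation terms remain. *)
Lemma characteristic_shift (s a : nat -> R[i]) k :
  characteristic_poly = \prod_(j < d) ('X - (s j)%:P) ->
  shift_chain s a d k = a (k + d)%N - \sum_(j < d) c j * a (k + (d - j.+1))%N.
Proof.
have mono m : (m <= d)%N -> \sum_(l < d.+1) ('X^m : {poly R[i]})`_l * a (k + l)%N = a (k + m)%N.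
  move=> md; rewrite (bigD1 (Ordinal (md : m < d.+1)%N))//= coefXn eqxx mul1r.
  rewrite big1 ?addr0// => l hl; rewrite coefXn (_ : _ == _ = false) ?mul0r//.
  by apply/negbTE; apply: contra hl => /eqP h; apply/eqP/val_inj.
move=> hP; rewrite shift_chainE -hP /characteristic_poly.
under eq_bigr do rewrite coefB coef_sum mulrBl mulr_suml.
rewrite sumrB mono// exchange_big; congr (_ - _); apply: eq_bigr => j _.
under eq_bigr do rewrite coefZ -mulrA.
by rewrite -mulr_sumr mono// leq_subr.
Qed.

(** * Elementary properties of solutions *)

Variables (psi : 'I_d -> nat -> R[i]) (a : nat -> R[i]).
Hypothesis hrec : poincare_recurrence c psi a.

(** d consecutive zeros propagate, whatever the coefficients are. *)
Lemma vanishing_window k :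
  (forall l, (l < d)%N -> a (k + l)%N = 0) -> forall m, (k <= m)%N -> a m = 0.
Proof.
move=> h m; have [n] := ubnP m; elim: n m => // n IH m mn km.
have [lt|ge] := ltnP m (k + d).
  by rewrite -(subnKC km) h// ltn_subLR.
have [_ ->] := hrec; last exact: leq_trans (leq_addl _ _) ge.
apply: big1 => j _; have jd := ltn_ord j; rewrite IH ?mulr0//.
  rewrite -ltnS (leq_trans _ mn)// ltnS ltn_subrL/= (leq_trans _ ge)//.
  by rewrite (leq_trans _ (leq_addl _ _))// (leq_ltn_trans _ jd).
rewrite leq_subRL ?(leq_trans jd (leq_trans (leq_addl _ _) ge))//.
by rewrite addnC (leq_trans _ ge)// leq_add2l.
Qed.

Lemma recurrence_order_gt0 : (exists k, a k <> 0) -> (0 < d)%N.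
Proof.
move=> [k ak]; rewrite lt0n; apply/eqP => d0; apply: ak.
by apply: (@vanishing_window 0%N) => // l; rewrite d0.
Qed.

(** The coefficients are bounded, so one step of the recurrence multiplies the
    running geometric bound by at most the sum of the coefficient bounds. *)
Lemma exponential_bound :
  exists2 s : R, 0 < s & exists C, forall k, normc (a k) <= C * s ^+ k.
Proof.
have hb j : exists B, forall k, normc (c j + psi j k) <= B.
  have [K hK] := cvg0_normc_lt (hrec.1 j) ltr01.
  have [B B0 hB] := bounded_of_eventually (fun k => normc_ge0 _) (fun k h => ltW (hK k h)).
  exists (normc (c j) + B) => k; apply: le_trans (ler_normcD _ _) _.
  by rewrite lerD2l.
have [B hB] := choice hb.
pose s := 1 + \sum_(j < d) B j.
have B0 j : 0 <= B j by apply: le_trans (normc_ge0 _) (hB j 0%N).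
have sB : \sum_(j < d) B j <= s by rewrite lerDr.
have s1 : 1 <= s by rewrite lerDl sumr_ge0.
have s0 : 0 < s by lra.
exists s => //; pose C := \sum_(k < d) normc (a k); exists C => k.
have C0 : 0 <= C by apply: sumr_ge0 => *; exact: normc_ge0.
have [n] := ubnP k; elim: n k => // n IH k kn.
have [kd|dk] := ltnP k d.
  apply: (@le_trans _ _ C); last by rewrite ler_peMr// exprn_ege1.
  by rewrite /C (bigD1 (Ordinal kd))//= lerDl sumr_ge0// => *; exact: normc_ge0.
have [_ ->//] := hrec; apply: le_trans (ler_normc_sum _ _ _) _.
case: k kn dk => [|k] kn dk.
  rewrite big1 => [|j _]; first by rewrite expr0 mulr1.
  by have := leq_trans (ltn_ord j) dk.
apply: (@le_trans _ _ (\sum_(j < d) B j * (C * s ^+ k))).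
  apply: ler_sum => j _; rewrite normcM ler_pM ?normc_ge0//.
  rewrite subSS; apply: le_trans (IH _ _) _.
    by rewrite -ltnS (leq_trans _ kn)// ltnS ltnS leq_subr.
  by rewrite ler_wpM2l// ler_weXn2l// leq_subr.
by rewrite -mulr_suml exprS [leRHS]mulrCA ler_wpM2r// mulr_ge0// exprn_ge0// ltW.
Qed.

End Factor.

Lemma shift_chain_bound (R : realType) (s a : nat -> R[i]) (C t : R) i :
  0 < t -> (forall k, normc (a k) <= C * t ^+ k) ->
  exists B, forall k, normc (shift_chain s a i k) <= B * t ^+ k.
Proof.
move=> t0 ha; elim: i => [|i [B hB]]; first by exists C.
exists (B * t + normc (s i) * B) => k /=.
apply: le_trans (ler_normcD _ _) _; rewrite [normc (- _)]normcN normcM mulrDl.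
apply: lerD; first by apply: le_trans (hB _) _; rewrite exprS mulrA.
by rewrite -mulrA ler_wpM2l ?normc_ge0.
Qed.

(** The triangular change of coordinates is inverted with a constant depending only
    on the s_i: by w_i(k+1) = s_i w_i(k) + w_{i+1}(k), the value w_i(k+j) is controlled by
    w_i(k), ..., w_{i+j}(k). For i = 0 this bounds a window of a. *)
Lemma shift_chain_recover (R : realType) (s a : nat -> R[i]) (d : nat) (M X : R) k :
  0 <= X -> (forall i, (i < d)%N -> normc (s i) + 1 <= M) ->
  (forall i, (i < d)%N -> normc (shift_chain s a i k) <= X) ->
  forall j i, (i + j < d)%N -> normc (shift_chain s a i (k + j)%N) <= M ^+ j * X.
Proof.
move=> X0 hM hX; elim=> [|j IH] i ij.
  by rewrite addn0 expr0 mul1r hX// -(addn0 i).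
have id : (i < d)%N by apply: leq_ltn_trans ij; exact: leq_addr.
have ij' : (i + j < d)%N by apply: leq_ltn_trans ij; rewrite leq_add2l.
have M0 : 0 <= M by apply: le_trans (hM i id); rewrite addr_ge0 ?normc_ge0.
have -> : shift_chain s a i (k + j.+1) =
    s i * shift_chain s a i (k + j) + shift_chain s a i.+1 (k + j).
  by rewrite /= addnS addrC subrK.
apply: le_trans (ler_normcD _ _) _; rewrite normcM exprS -mulrA.
apply: (@le_trans _ _ ((normc (s i) + 1) * (M ^+ j * X))).
  by rewrite mulrDl mul1r lerD ?ler_wpM2l ?normc_ge0 ?IH// addSn -addnS.
by rewrite ler_wpM2r ?hM// mulr_ge0// exprn_ge0.
Qed.

Lemma uniform_gap (R : realType) (d : nat) (mu : 'I_d -> R) (L : R) :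
  (forall i, mu i <> L) ->
  exists eta, [/\ 0 < eta, eta <= 1 &
    forall i, mu i <= L - 2 * eta \/ L + 2 * eta <= mu i].
Proof.
move=> h; pose eta := \big[Num.min/1]_(i < d) (`|mu i - L| / 2); exists eta; split.
- apply: lt_bigmin => // i _; rewrite divr_gt0// normr_gt0 subr_eq0; exact/eqP.
- exact: bigmin_le_id.
- move=> i; have : eta <= `|mu i - L| / 2 by exact: bigmin_le_cond.
  case: (ger0P (mu i - L)) => _ ?; [right|left]; lra.
Qed.

(** * The growth rate of a solution is the modulus of a root *)

Section Dichotomy.
Variables (R : realType) (d : nat) (c : 'I_d -> R[i]).
Variables (psi : 'I_d -> nat -> R[i]) (a : nat -> R[i]).
Hypothesis hrec : poincare_recurrence c psi a.

(** With w_i the sequences of [shift_chain] for the characteristic roots s_i, the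
    rescaled coordinates eta^-i w_i satisfy, for large k, the hypotheses of
    [cone_dichotomy] with mu_i = |s_i|: the rescaling turns the superdiagonal entries 1
    into eta, and the last row contains psi_j, which tends to zero. *)
Lemma growth_dichotomy (L : R) : 0 <= L -> ~ eventually_zero a ->
  (forall sigma, characteristic_root c sigma -> normc sigma <> L) ->
  (exists2 t, L < t & ~ exists C, forall k, normc (a k) <= C * t ^+ k) \/
  (exists s, [/\ 0 < s, s < L & exists C, forall k, normc (a k) <= C * s ^+ k]).
Proof.
move=> L0 nez noroot.
have d0 : (0 < d)%N.
  apply: (recurrence_order_gt0 hrec); apply: contrapT => h; apply: nez; exists 0%N => k _.
  by apply: contrapT => ak; apply: h; exists k.
have [s hs sroot] := characteristic_factorization c.
have [eta [e0 e1 gap]] := @uniform_gap R d (fun i => normc (s i)) L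
  (fun i => noroot _ (sroot i (ltn_ord i))).
set w := shift_chain s a.
pose M := 1 + \sum_(i < d) normc (s i).
have hM i : (i < d)%N -> normc (s i) + 1 <= M.
  move=> id; rewrite addrC lerD2l (bigD1 (Ordinal id))//= lerDl sumr_ge0// => *.
  exact: normc_ge0.
have M1 : 1 <= M by rewrite lerDl sumr_ge0// => *; exact: normc_ge0.
have M0 : 0 < M by exact: lt_le_trans M1.
have recover k X : 0 <= X -> (forall i, (i < d)%N -> normc (w i k) <= X) ->
    forall l, (l < d)%N -> normc (a (k + l)%N) <= M ^+ d * X.
  move=> X0 hX l ld; apply: le_trans (shift_chain_recover X0 hM hX (_ : (0 + l < d)%N)) _ => //.
  by rewrite ler_wpM2r// ler_weXn2l// ltnW.
(* Perturbations below delta contribute at most eta^d times the largest |w_i|: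
   there are d of them, each multiplying a term bounded by M^d max |w_i|. *)
pose delta := eta ^+ d / (d%:R * M ^+ d).
have dM0 : 0 < d%:R * M ^+ d by rewrite mulr_gt0 ?ltr0n// exprn_gt0.
have delta0 : 0 < delta by rewrite divr_gt0// exprn_gt0.
have [K hK] := uniform_threshold (fun j => cvg0_normc_lt (hrec.1 j) delta0).
have top k X : (K <= k)%N -> 0 <= X -> (forall i, (i < d)%N -> normc (w i k) <= X) ->
    normc (w d k) <= eta ^+ d * X.
  move=> Kk X0 hX.
  have -> : w d k = \sum_(j < d) psi j (k + d)%N * a (k + (d - j.+1))%N.
    rewrite /w (characteristic_shift _ _ hs) hrec.2 ?leq_addl// -sumrB.
    by apply: eq_bigr => j _; rewrite addnBA// mulrDl addrC addKr.
  apply: le_trans (ler_normc_sum _ _ _) _.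
  apply: (@le_trans _ _ (\sum_(j < d) delta * (M ^+ d * X))).
    apply: ler_sum => j _; rewrite normcM ler_pM ?normc_ge0//.
      by apply/ltW/hK; exact: leq_trans (leq_addr _ _).
    by apply: recover => //; rewrite ltn_subrL.
  rewrite sumr_const card_ord -mulr_natl mulrA mulrA [d%:R * _]mulrC /delta.
  by rewrite -[X in X * _]mulrA divfK ?gt_eqF.
pose x (i : 'I_d) n := eta ^- i * normc (w i (K + n)%N).
have ei0 i : 0 < eta ^- i by rewrite invr_gt0 exprn_gt0.
have x0 i n : 0 <= x i n by rewrite mulr_ge0 ?normc_ge0// ltW.
have wx (i : 'I_d) n X : x i n <= X -> normc (w i (K + n)%N) <= eta ^+ i * X.
  by move=> h; rewrite -ler_pdivrMl ?exprn_gt0.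
have wx' n X : (forall j, x j n <= X) ->
    forall i, (i < d)%N -> normc (w i (K + n)%N) <= X.
  move=> h i id; have X0 : 0 <= X by apply: le_trans (h (Ordinal id)); exact: x0.
  apply: le_trans (wx (Ordinal id) _ _ (h _)) _.
  by rewrite ler_piMl// exprn_ile1// ltW.
have step (i : 'I_d) n X : (forall j, x j n <= X) ->
    `|x i n.+1 - normc (s i) * x i n| <= eta * X.
  move=> h; have X0 : 0 <= X by apply: le_trans (h i); exact: x0.
  have up : normc (w i.+1 (K + n)%N) <= eta ^+ i.+1 * X.
    have := ltn_ord i; rewrite leq_eqVlt => /orP[/eqP ->|id].
      apply: top => //; [exact: leq_addr|exact: wx'].
    exact: (wx (Ordinal id) _ _ (h _)).
  rewrite /x mulrCA -mulrBr normrM gtr0_norm// -normcM ler_pdivrMl ?exprn_gt0//.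
  rewrite mulrA -exprSr; apply: le_trans up.
  by rewrite addnS; exact: ler_dist_normc.
have nz n : exists i, 0 < x i n.
  apply: contrapT => h; apply: nez; exists (K + n)%N; apply: (vanishing_window hrec).
  move=> l ld; apply: eq0_normc; apply/le_anti; rewrite normc_ge0 andbT.
  rewrite -(mulr0 (M ^+ d)); apply: recover => // i id; apply: (@wx' n 0) => // j.
  by rewrite leNgt; apply/negP => h'; apply: h; exists j.
have [[n0 [u u0 grow]]|[Le [C decay]]] :=
    cone_dichotomy L0 e0 x0 (fun i => normc_ge0 (s i)) gap step nz.
- left; exists (L + eta / 2); first lra.
  set t := L + eta / 2 => -[C hC].
  have t0 : 0 < t by rewrite /t; lra.
  have te : t < L + eta by rewrite /t; lra.
  have /choice[B hB] : forall i : 'I_d, exists B, forall n, x i (n0 + n)%N <= B * t ^+ n.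
    move=> i; have [B hB] := shift_chain_bound s i t0 hC.
    exists (eta ^- i * (B * t ^+ (K + n0))) => n.
    by rewrite -mulrA ler_wpM2l ?(ltW (ei0 _))// -mulrA -exprD -addnA.
  pose D := \sum_i `|B i|.
  (* (L + eta)^k u would stay below D t^k although t < L + eta. *)
  have [k hk] := geometric_gap ((D + 1) / u) (ltW t0) te.
  have [i hi] := grow k.
  have tk : 0 < t ^+ k by rewrite exprn_gt0.
  have h1 : (D + 1) * t ^+ k <= D * t ^+ k.
    apply: (@le_trans _ _ (x i (n0 + k)%N)).
      apply: le_trans hi; rewrite -ler_pdivrMr// mulrAC; exact: hk.
    apply: le_trans (hB i k) _; rewrite ler_pM2r//.
    by rewrite /D (bigD1 i)//= -[leLHS]addr0 lerD ?ler_norm// sumr_ge0.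
  by move: h1; rewrite ler_pM2r//; lra.
- right; exists (L - eta); split => //; first lra.
  have [||B _ hB] := @bounded_of_eventually R (fun k => normc (a k) / (L - eta) ^+ k)
    (C / (L - eta) ^+ K) K.
  + by move=> k; rewrite divr_ge0 ?normc_ge0// exprn_ge0// ltW.
  + move=> k Kk; have := decay (Ordinal d0) (k - K)%N.
    rewrite /x /= expr0 invr1 mul1r subnKC// => h.
    rewrite ler_pdivrMr ?exprn_gt0//; apply: le_trans h _.
    rewrite mulrC -{2}(subnK Kk) exprD -mulrA [X in _ <= C * X]mulrCA.
    by rewrite mulVf ?mulr1// gt_eqF// exprn_gt0.
  exists B => k; rewrite -ler_pdivrMr ?exprn_gt0//.
Qed.

End Dichotomy.

(** * The radius of convergence of a solution *)

Section Radius.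
Variables (R : realType) (d : nat) (c : 'I_d -> R[i]).
Variables (psi : 'I_d -> nat -> R[i]) (a : nat -> R[i]).
Hypothesis hrec : poincare_recurrence c psi a.

Lemma radius_gt0 : (0 < radius_of_convergence a)%E.
Proof.
have [s s0 [C hC]] := exponential_bound hrec.
by apply: lt_le_trans (radius_ge s0 hC); rewrite lte_fin invr_gt0.
Qed.

(** The number L = 1/radius is the exponential growth rate of a. Both alternatives
    of [growth_dichotomy] contradict this: the first one says that a grows faster, the
    second one that a grows slower. *)
Lemma radius_characteristic : ~ eventually_zero a ->
  exists sigma, characteristic_root c sigma /\
    radius_of_convergence a = ((normc sigma)%:E^-1)%E.
Proof.
move=> nez.
have [L L0 hL] : exists2 L : R, 0 <= L & radius_of_convergence a = (L%:E^-1)%E.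
  move: radius_gt0; case: (radius_of_convergence a) => [r||] //.
    rewrite lte_fin => r0; exists r^-1; first by rewrite invr_ge0 ltW.
    by rewrite inver invr_eq0 gt_eqF// invrK.
  by move=> _; exists 0 => //; rewrite inve0.
apply: contrapT => hno.
have noroot sigma : characteristic_root c sigma -> normc sigma <> L.
  by move=> h e; apply: hno; exists sigma; split=> //; rewrite hL e.
have [[t Lt]|[s [s0 sL [C hC]]]] := growth_dichotomy hrec L0 nez noroot.
- apply; have t0 : 0 < t by exact: le_lt_trans Lt.
  apply: radius_gt_bound => //; rewrite hL.
  have [->|Ln0] := eqVneq L 0; first by rewrite inve0 ltry.
  by rewrite inver (negbTE Ln0) lte_fin ltf_pV2 ?posrE// lt_neqAle eq_sym Ln0.
- have Lp : 0 < L by exact: lt_trans sL.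
  have := radius_ge s0 hC; rewrite hL inver gt_eqF// lee_fin.
  by rewrite leNgt ltf_pV2 ?posrE// sL.
Qed.

(** With S as chosen, the inequality is an identity when the maximum is replaced by
    its term of index m, and m is at most d-1 by [vanishing_window]. It is subexponential because the radius is at
    least r. *)
Lemma domination_by_first_coefficient (r : R) (m : nat) :
  radius_of_convergence a = r%:E -> a m <> 0 -> (forall i, (i < m)%N -> a i = 0) ->
  taylor_domination a d.-1 r
    (fun k => r ^+ k * normc (a k) * (normc (a m) * r ^+ m)^-1).
Proof.
move=> hr am mfirst.
have r0 : 0 < r by rewrite -lte_fin -hr; exact: radius_gt0.
have amr : 0 < normc (a m) * r ^+ m by rewrite mulr_gt0 ?normc_gt0 ?exprn_gt0.
have md : (m < d)%N.
  rewrite ltnNge; apply/negP => dm; apply: am.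
  apply: (vanishing_window hrec (k := 0%N)) => // l ld.
  by apply: mfirst; exact: leq_trans dm.
have S0 k : 0 <= r ^+ k * normc (a k) * (normc (a m) * r ^+ m)^-1.
  by rewrite !mulr_ge0 ?invr_ge0 ?normc_ge0 ?exprn_ge0 ?ltW.
split=> //; first by rewrite hr.
- apply: subexponential_of_bounds => // t t1.
  have t0 : 0 < t by lra.
  have [||C hC] := @radius_gt_bound _ a (t / r); first exact: divr_gt0.
    by rewrite hr lte_fin invf_div ltr_pdivrMr// ltr_pMr.
  exists (C * (normc (a m) * r ^+ m)^-1) => k.
  rewrite [leRHS]mulrAC ler_wpM2r ?invr_ge0 ?(ltW amr)//.
  have := hC k; rewrite expr_div_n mulrA ler_pdivlMr ?exprn_gt0// mulrC => h.
  exact: h.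
- move=> k _; have rk : 0 < r ^+ k by exact: exprn_gt0.
  apply: (@le_trans _ _ ((r ^+ k * normc (a k) * (normc (a m) * r ^+ m)^-1)
                           * (normc (a m) * r ^+ m))).
    by rewrite divfK ?gt_eqF// mulrC.
  rewrite ler_wpM2l//.
  have md' : (m < d.-1.+1)%N by rewrite (leq_trans md)// leqSpred.
  exact: (le_bigmax_cond 0 (fun i : 'I_d.-1.+1 => normc (a i) * r ^+ i) (j := Ordinal md')).
Qed.
End Radius.

(** * Radius of convergence and Taylor domination *)

Theorem theorem5p2 (R : realType) (d : nat) (c : 'I_d -> R[i])
    (psi : 'I_d -> nat -> R[i]) (a : nat -> R[i])
    (hrec : poincare_recurrence c psi a)
    (hnz : exists k : nat, a k <> 0) :
  [/\ (0 < radius_of_convergence a)%E,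
      ~ eventually_zero a ->
        exists sigma : R[i], characteristic_root c sigma /\
          radius_of_convergence a = ((normc sigma)%:E^-1)%E &
      forall (r : R) (m : nat), radius_of_convergence a = r%:E ->
        a m <> 0 -> (forall i : nat, (i < m)%N -> a i = 0) ->
        taylor_domination a d.-1 r
          (fun k => r ^+ k * normc (a k) * (normc (a m) * r ^+ m)^-1)].
Proof.
split.
- exact: radius_gt0 hrec.
- exact: radius_characteristic hrec.
- move=> r m; exact: domination_by_first_coefficient hrec r m.
Qed.
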